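(* Let $K$ be a commutative ring with $\frac{1}{2}\in K$, let $n\ge 1$ and let $\Lambda_n=\Lambda_n(K)$ be the Grassmann algebra. Then: 1. $\mathrm{Der}_K(\Lambda_n)=\mathrm{Der}_K(\Lambda_n)^{ev}\oplus \mathrm{Der}_K(\Lambda_n)^{od}$. 2. $\mathrm{Der}_K(\Lambda_n)^{ev}=\bigoplus_{i=1}^n \Lambda_n^{od}\partial_i$. 3. $\mathrm{Der}_K(\Lambda_n)^{od}=\mathrm{IDer}_K(\Lambda_n)$, and the map $\mathrm{ad}:\Lambda_n'^{od}=\Lambda_n^{od}/(\Lambda_n^{od}\cap Z(\Lambda_n))\to \mathrm{IDer}_K(\Lambda_n)$, $a\mapsto \mathrm{ad}(a)$, is an isomorphism of $Z(\Lambda_n)$-modules. 4. $\mathrm{Der}_K(\Lambda_n)/\mathrm{IDer}_K(\Lambda_n)\simeq \mathrm{Der}_K(\Lambda_n)^{ev}$ (as left $\Lambda_n^{ev}$-modules).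
   Context: $\Lambda_n=\Lambda_n(K)=K\lfloor x_1,\ldots,x_n\rfloor$ is the $K$-algebra with generators $x_1,\ldots,x_n$ and defining relations $x_i^2=0$, $x_ix_j=-x_jx_i$ ($i\ne j$); it is a free $K$-module with basis $x^\alpha=x_1^{\alpha_1}\cdots x_n^{\alpha_n}$, $\alpha\in\{0,1\}^n$. Put $|\alpha|=\alpha_1+\cdots+\alpha_n$, $\Lambda_{n,i}=\bigoplus_{|\alpha|=i}Kx^\alpha$, $\Lambda_n^{ev}=\bigoplus_{i\text{ even}}\Lambda_{n,i}$, $\Lambda_n^{od}=\bigoplus_{i\text{ odd}}\Lambda_{n,i}$. $Z(\Lambda_n)$ is the centre. $\partial_1,\ldots,\partial_n:\Lambda_n\to\Lambda_n$ are the $K$-linear partial skew derivatives, determined by $\partial_i(x_j)=\delta_{ij}$ and $\partial_i(ab)=\partial_i(a)b+(-1)^s a\,\partial_i(b)$ for $a\in\Lambda_{n,s}$, $b\in \Lambda_n$. $\Lambda_n^{od}\partial_i$ denotes the set of maps $b\mapsto a\partial_i(b)$ with $a\in\Lambda_n^{od}$. $\mathrm{Der}_K(\Lambda_n)$ is the set of all $K$-linear derivations of $\Lambda_n$. $\mathrm{Der}_K(\Lambda_n)^{ev}$ is the set of those preserving parity ($\delta(\Lambda_n^{ev})\subseteq\Lambda_n^{ev}$, $\delta(\Lambda_n^{od})\subseteq\Lambda_n^{od}$), and $\mathrm{Der}_K(\Lambda_n)^{od}$ the set of those reversing parity ($\delta(\Lambda_n^{ev})\subseteq\Lambda_n^{od}$,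 $\delta(\Lambda_n^{od})\subseteq\Lambda_n^{ev}$). $\mathrm{ad}(a)(b)=ab-ba$ and $\mathrm{IDer}_K(\Lambda_n)=\{\mathrm{ad}(a)\mid a\in\Lambda_n\}$. $\Lambda_n'^{od}=\Lambda_n^{od}$ if $n$ is even; if $n$ is odd, $\Lambda_n'^{od}$ is the $K$-submodule of $\Lambda_n^{od}$ spanned by all odd-degree monomials $x^\alpha$ other than $x_1\cdots x_n$. One has $\Lambda_n^{od}=\Lambda_n'^{od}\oplus(\Lambda_n^{od}\cap Z(\Lambda_n))$, through which $\Lambda_n'^{od}$ is identified with $\Lambda_n^{od}/(\Lambda_n^{od}\cap Z(\Lambda_n))$. *)

(* Defs.v *)
From HB Require Import structures.
From mathcomp Require Import boolp classical_sets functions.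
From mathcomp Require Import all_boot all_algebra ring.

Set Implicit Arguments.
Unset Strict Implicit.
Unset Printing Implicit Defensive.

Import GRing.Theory.

Local Open Scope ring_scope.
Local Open Scope quotient_scope.

(* The number of pairs (i, j) in A x B with j < i, so that, for disjoint A    *)
(* and B, x^A x^B = (-1)^(ninv A B) x^(A u B).                                *)
Definition ninv n (A B : {set 'I_n}) : nat :=
  (\sum_(i in A) \sum_(j in B) (j < i))%N.

Section NinvTheory.
Variable n : nat.
Implicit Types A B C : {set 'I_n}.

Lemma ninv0s A : ninv set0 A = 0%N.
Proof. by rewrite /ninv big_set0. Qed.

Lemma ninvs0 A : ninv A set0 = 0%N.
Proof. by rewrite /ninv big1 // => i _; rewrite big_set0. Qed.

Let sumU A B (F : 'I_n -> nat) : [disjoint A & B] ->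
  (\sum_(i in A :|: B) F i = \sum_(i in A) F i + \sum_(i in B) F i)%N.
Proof.
by move=> dAB; rewrite -bigU //; apply: eq_bigl => i; rewrite !inE.
Qed.

Lemma ninvUl A B C : [disjoint A & B] ->
  ninv (A :|: B) C = (ninv A C + ninv B C)%N.
Proof. by move=> dAB; rewrite /ninv sumU. Qed.

Lemma ninvUr A B C : [disjoint B & C] ->
  ninv A (B :|: C) = (ninv A B + ninv A C)%N.
Proof.
move=> dBC; rewrite /ninv -big_split /=; apply: eq_bigr => i _.
by rewrite sumU.
Qed.

Lemma ninv_sym A B : [disjoint A & B] ->
  (ninv A B + ninv B A = #|A| * #|B|)%N.
Proof.
move=> dAB; rewrite /ninv [X in (_ + X)%N]exchange_big -big_split /=.
rewrite -sum_nat_const; apply: eq_bigr => i iA.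
rewrite -big_split /= -sum1_card; apply: eq_bigr => j jB.
have : i != j.
  by apply: contraTneq jB => <-; rewrite (disjointFr dAB).
by rewrite -val_eqE /=; case: ltngtP.
Qed.

End NinvTheory.

(* The Grassmann algebra is modelled on its monomial basis: a coefficient     *)
(* family f stands for the sum of the f A *: x^A, where A is the support of   *)
(* the exponent in {0,1}^n. The presentation is recovered by ggen_sqr and     *)
(* ggen_anti, together with gmonoE_prod and grass_basis. As K may be trivial, *)
(* there is no algType instance, only grass_scalerAl and grass_scalerAr.      *)
Definition grass (K : comPzRingType) (n : nat) : Type :=
  {ffun {set 'I_n} -> K}.

Section GrassmannAlgebra.
Variables (K : comPzRingType) (n : nat).
Local Notation L := (grass K n).

HB.instance Definition _ := GRing.Zmodule.copy L {ffun {set 'I_n} -> K}.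

Implicit Types (f g h : L) (A B C : {set 'I_n}).

Lemma grassP f g : (forall A, f A = g A) -> f = g.
Proof. by move=> e; apply/ffunP. Qed.

Lemma grass0E A : (0 : L) A = 0. Proof. exact: ffunE. Qed.
Lemma grassDE f g A : (f + g) A = f A + g A. Proof. exact: ffunE. Qed.
Lemma grassNE f A : (- f) A = - f A. Proof. exact: ffunE. Qed.

Definition gscale (c : K) f : L := [ffun A => c * f A].

Let gscaleA a b f : gscale a (gscale b f) = gscale (a * b) f.
Proof. by apply/ffunP => A; rewrite !ffunE mulrA. Qed.
Let gscale1 : left_id 1 gscale.
Proof. by move=> f; apply/ffunP => A; rewrite !ffunE mul1r. Qed.
Let gscaleDr : right_distributive gscale +%R.
Proof. by move=> a f g; apply/ffunP => A; rewrite !ffunE mulrDr. Qed.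
Let gscaleDl f : {morph gscale^~ f : a b / a + b}.
Proof. by move=> a b; apply/ffunP => A; rewrite !ffunE mulrDl. Qed.

HB.instance Definition _ :=
  GRing.Zmodule_isLmodule.Build K L gscaleA gscale1 gscaleDr gscaleDl.

Lemma grassZE (c : K) f A : (c *: f) A = c * f A. Proof. exact: ffunE. Qed.
Definition grassE := (grass0E, grassDE, grassNE, grassZE).

Definition gmono A : L := [ffun B => (B == A)%:R].
Definition ggen (i : 'I_n) : L := gmono [set i].

Definition gmul f g : L :=
  [ffun C : {set 'I_n} => \sum_(A : {set 'I_n} | A \subset C)
     (-1) ^+ ninv A (C :\: A) * (f A * g (C :\: A))].

Lemma gmonoE A B : gmono A B = (B == A)%:R. Proof. exact: ffunE. Qed.

Lemma gmulE f g C : gmul f g C = \sum_(A : {set 'I_n} | A \subset C)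
     (-1) ^+ ninv A (C :\: A) * (f A * g (C :\: A)).
Proof. exact: ffunE. Qed.

Lemma gmulA : associative gmul.
Proof.
move=> f g h; apply: grassP => D; rewrite !gmulE.
under [RHS]eq_bigr => C CD.
  rewrite gmulE mulr_suml mulr_sumr; over.
rewrite (exchange_big_dep (fun A => A \subset D)) /=; last first.
  by move=> C A CD AC; apply: subset_trans CD.
apply: eq_bigr => A AD; rewrite gmulE mulr_sumr mulr_sumr.
rewrite [RHS](reindex_onto (fun B => A :|: B) (fun C => C :\: A)) /=; last first.
  move=> C /andP[CD AC]; apply/setP => i; rewrite !inE.
  by case: (boolP (i \in A)) => //= /(subsetP AC).
apply: eq_big => [B | B].
  apply/esym; rewrite subUset AD subsetUl andbT /= setDUl setDv set0U subsetD.
  by congr (_ && _); apply/eqP/setDidPl.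
rewrite subsetD => /andP[BD dBA].
have dAB : [disjoint A & B] by rewrite disjoint_sym.
have -> : (A :|: B) :\: A = B by rewrite setDUl setDv set0U; apply/setDidPl.
rewrite setDDl.
have -> : D :\: A = B :|: (D :\: (A :|: B)).
  apply/setP => i; rewrite !inE.
  have [iB | iB] := boolP (i \in B); last by rewrite orbF.
  by rewrite (subsetP BD) // (disjointFl dAB).
rewrite ninvUr; last by rewrite -setI_eq0; apply/eqP/setP => i; rewrite !inE; case: (i \in B); rewrite ?orbT ?andbF.
rewrite ninvUl // !exprD !mulrA.
ring.
Qed.

Let gmul1 : left_id (gmono set0) gmul.
Proof.
move=> f; apply: grassP => C; rewrite gmulE (bigD1 set0) ?sub0set //=.
rewrite big1 => [|A /andP[_ /negPf A0]]; last first.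
  by rewrite gmonoE A0 mul0r mulr0.
by rewrite gmonoE eqxx setD0 ninv0s expr0 !mul1r addr0.
Qed.

Let gmulr1 : right_id (gmono set0) gmul.
Proof.
move=> f; apply: grassP => C; rewrite gmulE (bigD1 C) //=.
rewrite big1 => [|A /andP[AC nAC]]; last first.
  rewrite gmonoE setD_eq0 [C \subset A](_ : _ = false) ?mulr0 //.
  by apply: contraNF nAC => CA; rewrite eqEsubset AC.
by rewrite setDv gmonoE eqxx ninvs0 expr0 mul1r mulr1 addr0.
Qed.

Let gmulDl : left_distributive gmul +%R.
Proof.
move=> f g h; apply: grassP => C; rewrite grassE !gmulE -big_split /=.
by apply: eq_bigr => A _; rewrite grassE mulrDl mulrDr.
Qed.

Let gmulDr : right_distributive gmul +%R.
Proof.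
move=> f g h; apply: grassP => C; rewrite grassE !gmulE -big_split /=.
by apply: eq_bigr => A _; rewrite grassE !mulrDr.
Qed.

HB.instance Definition _ :=
  GRing.Zmodule_isPzRing.Build L gmulA gmul1 gmulr1 gmulDl gmulDr.

Lemma grassME f g C : (f * g) C = \sum_(A : {set 'I_n} | A \subset C)
  (-1) ^+ ninv A (C :\: A) * (f A * g (C :\: A)).
Proof. exact: gmulE. Qed.

Lemma grass1E A : (1 : L) A = (A == set0)%:R.
Proof. exact: gmonoE. Qed.

Lemma grass_scalerAl (c : K) f g : c *: (f * g) = c *: f * g.
Proof.
apply: grassP => C; rewrite grassE !grassME mulr_sumr.
by apply: eq_bigr => A _; rewrite grassE; ring.
Qed.

Lemma grass_scalerAr (c : K) f g : c *: (f * g) = f * (c *: g).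
Proof.
apply: grassP => C; rewrite grassE !grassME mulr_sumr.
by apply: eq_bigr => A _; rewrite grassE; ring.
Qed.

Lemma grass_sumE (I : Type) (r : seq I) (P : pred I) (F : I -> L) A :
  (\sum_(i <- r | P i) F i) A = \sum_(i <- r | P i) F i A.
Proof.
by elim/big_rec2: _ => [|i y1 y2 _ <-]; rewrite grassE.
Qed.

Lemma grass_basis f : f = \sum_A f A *: gmono A.
Proof.
apply: grassP => B; rewrite grass_sumE (bigD1 B) //= big1 => [|A nAB].
  by rewrite grassE gmonoE eqxx mulr1 addr0.
by rewrite grassE gmonoE eq_sym (negPf nAB) mulr0.
Qed.

Lemma gmonoM A B : gmono A * gmono B =
  if [disjoint A & B] then (-1) ^+ ninv A B *: gmono (A :|: B) else 0.
Proof.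
apply: grassP => C; rewrite grassME.
have -> : (if [disjoint A & B] then (-1) ^+ ninv A B *: gmono (A :|: B) else 0) C
    = (-1) ^+ ninv A B * ([disjoint A & B] && (C == A :|: B))%:R.
  by case: ifP => _; rewrite grassE ?gmonoE ?mulr0.
have eAB : [disjoint A & B] && (C == A :|: B) = (A \subset C) && (C :\: A == B).
  apply/andP/andP => [[dAB /eqP->]|[AC /eqP<-]]; split.
  - exact: subsetUl.
  - by rewrite setDUl setDv set0U; apply/eqP/setDidPl; rewrite disjoint_sym.
  - by rewrite -setI_eq0; apply/eqP/setP => i; rewrite !inE; case: (i \in A).
  - apply/eqP/setP => i; rewrite !inE.
    by case: (boolP (i \in A)) => //= /(subsetP AC).
have [AC|nAC] := boolP (A \subset C); last first.
  rewrite eAB (negPf nAC) mulr0 big1 // => A' A'C.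
  rewrite !gmonoE (_ : (A' == A) = false) ?mul0r ?mulr0 //.
  by apply: contraNF nAC => /eqP <-.
rewrite (bigD1 A) //= big1 => [|A' /andP[_ /negPf nA']]; last first.
  by rewrite !gmonoE nA' mul0r mulr0.
rewrite eAB AC !gmonoE eqxx addr0 mul1r /=.
by case: eqP => [->|]; rewrite // !mulr0.
Qed.

Lemma ggen_sqr i : ggen i * ggen i = 0.
Proof. by rewrite gmonoM disjoints1 inE eqxx. Qed.

Lemma ggen_anti i j : i != j -> ggen i * ggen j = - (ggen j * ggen i).
Proof.
move=> nij; rewrite !gmonoM !disjoints1 !inE (eq_sym j) nij setUC -scaleNr.
rewrite /ninv !big_set1.
move: nij; rewrite -val_eqE /=.
by case: ltngtP => //= _ _; rewrite expr0 expr1 ?opprK.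
Qed.

Lemma gmonoE_prod A : gmono A = \prod_(i <- enum 'I_n | i \in A) ggen i.
Proof.
have : sorted ltn (map val (enum 'I_n)) by rewrite val_enum_ord iota_ltn_sorted.
have -> : gmono A = gmono [set i in enum 'I_n | i \in A].
  by congr gmono; apply/setP => i; rewrite inE mem_enum.
elim: (enum 'I_n) => [|i s IHs] /= is_s.
  rewrite big_nil; congr gmono; apply/setP => j; by rewrite !inE.
rewrite big_cons.
have is_lt := order_path_min ltn_trans is_s.
have nis : i \notin s.
  apply/negP => ins; have := allP is_lt (val i) (map_f _ ins).
  by rewrite ltnn.
rewrite -IHs ?(path_sorted is_s) //; case: ifP => iA; last first.
  congr gmono; apply/setP => j; rewrite !inE.
  by case: eqP => // ->; rewrite iA !andbF.
rewrite gmonoM disjoints1 inE (negPf nis) /=.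
rewrite {1}/ninv big_set1 big1 => [|j]; last first.
  rewrite inE => /andP[js _]; apply/eqP; rewrite eqb0 -leqNgt ltnW //.
  exact: (allP is_lt (val j) (map_f _ js)).
rewrite expr0 scale1r; congr gmono; apply/setP => j; rewrite !inE.
by case: eqP => // ->; rewrite iA.
Qed.

(* For i not in A, x^({i} u A) = (-1)^(ninv {i} A) x_i x^A is sent to         *)
(* (-1)^(ninv {i} A) x^A. See pderiv_gen, pderiv_skew and pderiv_unique.      *)
Definition pderiv (i : 'I_n) (f : L) : L :=
  [ffun A : {set 'I_n} =>
     if i \in A then 0 else (-1) ^+ ninv [set i] A * f (i |: A)].

Definition homog (s : nat) : {pred L} :=
  fun f => [forall A : {set 'I_n}, (f A != 0) ==> (#|A| == s)].

Lemma pderivE i f A :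
  pderiv i f A = if i \in A then 0 else (-1) ^+ ninv [set i] A * f (i |: A).
Proof. exact: ffunE. Qed.

Lemma pderiv_is_linear i : linear (pderiv i).
Proof.
move=> c f g; apply: grassP => A; rewrite grassDE grassZE !pderivE.
by case: ifP => _; rewrite ?mulr0 ?addr0 // grassDE grassZE; ring.
Qed.

Lemma pderiv_gen i j : pderiv i (ggen j) = (i == j)%:R.
Proof.
apply: grassP => A; rewrite pderivE gmonoE.
have -> : ((i == j)%:R : L) A = ((i == j) && (A == set0))%:R.
  by case: eqP => _; rewrite ?grass0E ?grass1E.
case: ifP => iA.
  by rewrite [A == _](_ : _ = false) ?andbF //; apply: contraTF iA => /eqP->; rewrite inE.
have [/andP[/eqP ij /eqP ->]|] := boolP ((i == j) && (A == set0)).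
  by rewrite ij setU0 eqxx ninvs0 expr0 mulr1.
move=> /negP nz; case: eqP => [e|_]; last by rewrite /= mulr0.
case: nz.
have ij : i = j by have := setU11 i A; rewrite e inE => /eqP.
rewrite ij eqxx /=; apply/eqP/setP => k; rewrite !inE.
have [->|nkj] := eqVneq k j; first by rewrite -ij.
by move/setP: e => /(_ k); rewrite !inE ij (negPf nkj).
Qed.

Let sum_subset1U i (D : {set 'I_n}) (F : {set 'I_n} -> K) : i \in D ->
  \sum_(B : {set 'I_n} | (B \subset D) && (i \in B)) F B =
  \sum_(A : {set 'I_n} | (A \subset D) && (i \notin A)) F (i |: A).
Proof.
move=> iD; rewrite (reindex_onto (fun A => i |: A) (fun B => B :\ i)) /=.
  apply: eq_bigl => A; rewrite subUset sub1set iD setU11 andbT /=.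
  congr (_ && _); apply/eqP/idP => [<-|iA]; first by rewrite !inE eqxx.
  by rewrite setU1K.
by move=> B /andP[_ iB]; rewrite setD1K.
Qed.

Let signE (a b : nat) : odd a = odd b -> (-1 : K) ^+ a = (-1) ^+ b.
Proof. by rewrite -(signr_odd _ a) => ->; rewrite signr_odd. Qed.

Lemma pderiv_skew i s f g : f \in homog s ->
  pderiv i (f * g) = pderiv i f * g + (-1) ^+ s *: (f * pderiv i g).
Proof.
move=> /forallP hf; apply: grassP => C.
have hs A : (-1) ^+ s * f A = (-1) ^+ #|A| * f A.
  have := hf A; have [->|_ /eqP <- //] := eqVneq (f A) 0; by rewrite !mulr0.
rewrite pderivE grassDE grassZE !grassME.
rewrite [in RHS]mulr_sumr [X in _ = X + _](bigID (fun A : {set 'I_n} => i \in A)) /=.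
rewrite [X in _ = X + _ + _]big1 ?add0r => [|A /andP[_ iA]]; last first.
  by rewrite pderivE iA mul0r mulr0.
have [iC | niC] := boolP (i \in C).
  rewrite [X in _ = _ + X](bigID (fun A : {set 'I_n} => i \in A)) /=.
  rewrite [X in _ = _ + (_ + X)]big1 ?addr0 => [|A /andP[_ niA]]; last first.
    by rewrite pderivE inE niA iC /= !mulr0.
  rewrite sum_subset1U // -big_split big1 //= => A /andP[AC niA].
  have -> : C :\: A = i |: (C :\: (i |: A)).
    apply/setP => j; rewrite !inE.
    by have [->|] := eqVneq j i; rewrite ?niA ?iC.
  rewrite !pderivE !inE eqxx (negPf niA) /=.
  set E := C :\: (i |: A); have dE : [disjoint [set i] & E].
    by rewrite disjoints1 !inE eqxx.
  have dA : [disjoint A & [set i]] by rewrite disjoint_sym disjoints1.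
  rewrite ninvUr // ninvUl 1?disjoint_sym //.
  set F := f _; set G := g _.
  have -> : (-1) ^+ s * ((-1) ^+ (ninv [set i] E + ninv A E) *
     (F * ((-1) ^+ ninv [set i] E * G))) =
     (-1) ^+ (ninv [set i] E + ninv A E) * (-1) ^+ ninv [set i] E * G
     * ((-1) ^+ s * F) by ring.
  rewrite hs cardsU1 niA add1n exprS.
  have -> : (-1 : K) ^+ #|A| = (-1) ^+ (ninv A [set i] + ninv [set i] A).
    by rewrite ninv_sym // cards1 muln1.
  rewrite !exprD; have := sqrr_sign K (ninv [set i] E); rewrite expr2 => ww.
  rewrite -/F; ring: ww.
rewrite mulr_sumr (bigID (fun A : {set 'I_n} => i \in A)) /=.
rewrite sum_subset1U ?setU11 //.
have e A : (A \subset i |: C) && (i \notin A) = (A \subset C) && (i \notin A).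
  have [iA | niA] := boolP (i \in A); rewrite ?andbF // !andbT.
  rewrite -subDset (_ : A :\ i = A) //; apply/setDidPl.
  by rewrite disjoint_sym disjoints1.
rewrite !(eq_bigl _ _ e).
have e' A : (A \subset C) && (i \notin A) = (A \subset C).
  by apply: andb_idr => AC; apply: contra niC => /(subsetP AC).
rewrite !(eq_bigl _ _ e').
have iCE A : A \subset C ->
    ninv [set i] C = (ninv [set i] A + ninv [set i] (C :\: A))%N.
  move=> AC; rewrite -ninvUr; last by rewrite -setI_eq0 setDE setICA setICr setI0.
  congr ninv; apply/setP => j; rewrite !inE.
  by case: (boolP (j \in A)) => //= /(subsetP AC).
congr (_ + _); apply: eq_bigr => A AC.
  have niA : i \notin A by apply: contra niC => /(subsetP AC).
  rewrite pderivE (negPf niA).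
  have -> : (i |: C) :\: (i |: A) = C :\: A.
    apply/setP => j; rewrite !inE.
    by have [->|] := eqVneq j i; rewrite ?(negPf niC) ?andbF.
  rewrite (iCE A AC) ninvUl ?disjoints1 // !exprD.
  have := sqrr_sign K (ninv [set i] (C :\: A)); rewrite expr2 => ww.
  ring: ww.
have niA : i \notin A by apply: contra niC => /(subsetP AC).
rewrite pderivE inE niA (negPf niC) /=.
have -> : (i |: C) :\: A = i |: (C :\: A).
  apply/setP => j; rewrite !inE.
  by have [->|] := eqVneq j i; rewrite ?niA.
have dA : [disjoint A & [set i]] by rewrite disjoint_sym disjoints1.
rewrite ninvUr; last by rewrite disjoints1 !inE negb_and niC orbT.
set G := g _.
have -> : (-1) ^+ s * ((-1) ^+ ninv A (C :\: A) *
     (f A * ((-1) ^+ ninv [set i] (C :\: A) * G))) =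
  (-1) ^+ ninv A (C :\: A) * (-1) ^+ ninv [set i] (C :\: A) * G
   * ((-1) ^+ s * f A) by ring.
rewrite hs (iCE A AC).
have -> : (-1 : K) ^+ #|A| = (-1) ^+ (ninv A [set i] + ninv [set i] A).
  by rewrite ninv_sym // cards1 muln1.
by rewrite !exprD; ring.
Qed.

Lemma gmonoD1 i (A : {set 'I_n}) : i \in A ->
  gmono A = (-1) ^+ ninv [set i] (A :\ i) *: (ggen i * gmono (A :\ i)).
Proof.
move=> iA; rewrite gmonoM disjoints1 !inE eqxx /= setD1K // scalerA.
by rewrite -expr2 sqrr_sign scale1r.
Qed.

Lemma gmono_homog A : gmono A \in homog #|A|.
Proof.
apply/forallP => B; rewrite gmonoE; apply/implyP.
by case: (eqVneq B A) => [-> //|]; rewrite eqxx.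
Qed.

Lemma pderiv_unique i (d : L -> L) :
    linear d -> (forall j, d (ggen j) = (i == j)%:R) ->
    (forall s f g, f \in homog s -> d (f * g) = d f * g + (-1) ^+ s *: (f * d g)) ->
  d =1 pderiv i.
Proof.
move=> lin_d d_gen d_skew f.
have add_zero (e : L -> L) : linear e -> e 0 = 0.
  by move=> /(_ (-1) 0 0); rewrite scaleN1r oppr0 addr0 scaleN1r addNr.
have lin_p := @pderiv_is_linear i.
have d1 e : (forall s f g, f \in homog s ->
    e (f * g) = e f * g + (-1) ^+ s *: (f * e g)) -> e 1 = 0.
  move=> /(_ _ (gmono set0) 1 (gmono_homog set0)).
  rewrite cards0 expr0 scale1r mul1r !mulr1 mul1r => /eqP.
  by rewrite -{1}[e 1]addr0 (inj_eq (addrI _)) eq_sym => /eqP.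
have mono A : d (gmono A) = pderiv i (gmono A).
  have [m] := ubnP #|A|; elim: m A => // m IHm A leAm.
  have [->|[j jA]] := set_0Vmem A.
    by rewrite d1 // d1 // => *; apply: pderiv_skew.
  have Zlin (e : L -> L) (c : K) h : linear e -> e (c *: h) = c *: e h.
    by move=> lin_e; rewrite -[c *: h]addr0 lin_e (add_zero e) ?addr0.
  rewrite (gmonoD1 jA) !Zlin //; congr (_ *: _).
  have hj : ggen j \in homog 1 by rewrite -(cards1 j) gmono_homog.
  rewrite (d_skew _ _ _ hj) (pderiv_skew _ _ hj) d_gen pderiv_gen IHm //.
  by move: leAm; rewrite (cardsD1 j) jA.
rewrite (grass_basis f); elim/big_rec: _ => [|A h _ IH].
  by rewrite !add_zero.
by rewrite lin_d lin_p mono IH.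
Qed.

End GrassmannAlgebra.

Section Parity.
Variables (K : comPzRingType) (n : nat).
Local Notation L := (grass K n).
Implicit Types (f g : L) (A B C : {set 'I_n}) (b c : bool).

(* gparity b is the sum of the homogeneous components of degrees s such that *)
(* odd s = b.                                                                *)
Definition gparity b : {pred L} :=
  fun f => [forall A : {set 'I_n}, (f A != 0) ==> (odd #|A| == b)].
Definition geven : {pred L} := gparity false.
Definition godd : {pred L} := gparity true.

(* The span of the odd monomials other than x_1 ... x_n when n is odd. *)
Definition godd' : {pred L} :=
  fun a => (a \in godd) && (odd n ==> (a [set: 'I_n] == 0)).

Definition gcentral : {pred L} := fun z => `[< forall f, z * f = f * z >].

Lemma gparityP b f :
  reflect (forall A, odd #|A| != b -> f A = 0) (f \in gparity b).
Proof.
apply: (iffP forallP) => h A; last first.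
  by apply/implyP; apply: contraR => /h ->.
by move=> nb; have := h A; case: eqP => //= _ /eqP e; rewrite e eqxx in nb.
Qed.

Lemma gcentralP z : reflect (forall f, z * f = f * z) (z \in gcentral).
Proof. exact: asboolP. Qed.

Lemma gparityB b : zmod_closed (gparity b).
Proof.
split=> [|f g /gparityP hf /gparityP hg]; apply/gparityP => A nA.
  by rewrite grassE.
by rewrite !grassE hf // hg // subrr.
Qed.

HB.instance Definition _ b := GRing.isZmodClosed.Build L (gparity b) (gparityB b).
HB.instance Definition _ := GRing.ZmodClosed.on geven.
HB.instance Definition _ := GRing.ZmodClosed.on godd.

Lemma gparityM b c f g :
  f \in gparity b -> g \in gparity c -> f * g \in gparity (b (+) c).
Proof.
move=> /gparityP hf /gparityP hg; apply/gparityP => C nC.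
rewrite grassME big1 // => A AC.
have [oA | /hf ->] := eqVneq (odd #|A|) b; last by rewrite mul0r mulr0.
rewrite hg ?mulr0 //; apply: contra_neq nC => <-.
by rewrite -oA -oddD -(cardsID A C) (setIidPr AC).
Qed.

Lemma gparity_comm b c f g : f \in gparity b -> g \in gparity c ->
  f * g = (-1) ^+ (b && c) *: (g * f).
Proof.
move=> /gparityP hf /gparityP hg; apply: grassP => C.
rewrite grassZE !grassME mulr_sumr.
have CK A : A \subset C -> C :\: (C :\: A) = A.
  by move=> AC; rewrite setDDr setDv set0U; apply/setIidPr.
rewrite (reindex_onto (fun A => C :\: A) (fun A => C :\: A)) //=.
have e A : (C :\: A \subset C) && (C :\: (C :\: A) == A) = (A \subset C).
  rewrite subsetDl /=; apply/eqP/idP => [<-|/CK //]; exact: subsetDl.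
rewrite (eq_bigl _ _ e); apply: eq_bigr => A AC; rewrite CK //.
have [oA | /hg ->] := eqVneq (odd #|A|) c; last by ring.
have [oB | /hf ->] := eqVneq (odd #|C :\: A|) b; last by ring.
have dA : [disjoint A & C :\: A] by rewrite -setI_eq0 setDE setICA setICr setI0.
have -> : (-1 : K) ^+ (b && c) = (-1) ^+ (ninv A (C :\: A) + ninv (C :\: A) A).
  by rewrite ninv_sym // -[RHS]signr_odd oddM oA oB andbC.
rewrite exprD; have := sqrr_sign K (ninv A (C :\: A)); rewrite expr2 => ww.
by ring: ww.
Qed.

Definition gproj b f : L := [ffun A : {set 'I_n} => if odd #|A| == b then f A else 0].

Lemma gproj_parity b f : gproj b f \in gparity b.
Proof. by apply/gparityP => A /negPf nA; rewrite ffunE nA. Qed.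

Lemma gproj_sum f : f = gproj false f + gproj true f.
Proof.
by apply: grassP => A; rewrite grassE !ffunE; case: odd; rewrite ?addr0 ?add0r.
Qed.

Lemma geven_central a : a \in geven -> a \in gcentral.
Proof.
move=> ha; apply/gcentralP => f; rewrite (gproj_sum f) mulrDl mulrDr.
by rewrite !(gparity_comm ha (gproj_parity _ f)) !expr0 !scale1r.
Qed.

Lemma geven_subring : subring_closed geven.
Proof.
split=> [|f g|f g]; last 2 first.
- exact: rpredB.
- exact: (@gparityM false false).
apply/gparityP => A oA; rewrite grass1E; case: (eqVneq A set0) => // A0.
by rewrite A0 cards0 in oA.
Qed.

Lemma gcentral_subring : subring_closed gcentral.
Proof.
split=> [|f g /gcentralP hf /gcentralP hg|f g /gcentralP hf /gcentralP hg];
  apply/gcentralP => h; first by rewrite mul1r mulr1.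
  by rewrite mulrBl mulrBr hf hg.
by rewrite -mulrA hg mulrA hf mulrA.
Qed.

HB.instance Definition _ := GRing.isSubringClosed.Build L geven geven_subring.
HB.instance Definition _ := GRing.isSubringClosed.Build L gcentral gcentral_subring.

End Parity.

Section SubringModules.
Variables (R : pzRingType) (S : subringClosed R).

Definition subring_of : Type := {z : R | z \in S}.
HB.instance Definition _ := [isSub of subring_of for @sval _ _].
HB.instance Definition _ := [Choice of subring_of by <:].
HB.instance Definition _ := 
  GRing.SubChoice_isSubPzRing.Build R _ subring_of (GRing.subringClosedP S).

Variables (V : lmodType R) (D : {pred V}).

Definition subring_submod_closed : Prop :=
  0 \in D /\ {in S, forall z, {in D &, forall u v, z *: u + v \in D}}.

Hypothesis Dcl : subring_submod_closed.

(* The S-module structure on the S-submodule D of the R-module V. *)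
Definition submod_over (_ : subring_submod_closed) : Type := {v : V | v \in D}.
Local Notation W := (submod_over Dcl).
HB.instance Definition _ := [isSub of W for @sval _ _].
HB.instance Definition _ := [Choice of W by <:].

Let Dzmod : zmod_closed D.
Proof.
have [D0 hD] := Dcl; split=> // u v uD vD.
by rewrite addrC -scaleN1r hD // rpredN1.
Qed.

HB.instance Definition _ := GRing.SubChoice_isSubZmodule.Build V D W Dzmod.

Let wscale_sub (z : subring_of) (w : W) : val z *: val w \in D.
Proof.
have [D0 hD] := Dcl; rewrite -[_ *: _]addr0.
by apply: hD D0; apply: valP.
Qed.

Definition wscale (z : subring_of) (w : W) : W :=
  exist (fun v => v \in D) _ (wscale_sub z w).

Let wscaleA a b w : wscale a (wscale b w) = wscale (a * b) w.
Proof. by apply: val_inj; rewrite /= scalerA. Qed.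
Let wscale1 : left_id 1 wscale.
Proof. by move=> w; apply: val_inj; rewrite /= scale1r. Qed.
Let wscaleDr : right_distributive wscale +%R.
Proof.
by move=> a u w; apply: val_inj; rewrite /= scalerDr.
Qed.
Let wscaleDl w : {morph wscale^~ w : a b / a + b}.
Proof.
by move=> a b; apply: val_inj; rewrite /= scalerDl.
Qed.

HB.instance Definition _ :=
  GRing.Zmodule_isLmodule.Build subring_of W wscaleA wscale1 wscaleDr wscaleDl.

End SubringModules.

Arguments geven : clear implicits.
Arguments godd : clear implicits.
Arguments godd' : clear implicits.
Arguments gcentral : clear implicits.

Section QuotientModule.
Variables (R : pzRingType) (V : lmodType R) (N : {pred V}).
Hypothesis Ncl : submod_closed N.

Definition submod_zmodClosed : zmodClosed V :=
  HB.pack N (GRing.isZmodClosed.Build V N (GRing.submod_closedB Ncl)).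

Definition quot_mod : Type := Quotient.quot submod_zmodClosed.
Local Notation Q := quot_mod.

HB.instance Definition _ := GRing.Zmodule.copy Q (Quotient.quot submod_zmodClosed).
HB.instance Definition _ :=
  EqQuotient.copy Q (Quotient.quot submod_zmodClosed).

Lemma quot_mod_eq (u v : V) : (u - v \in N) = (\pi_Q u == \pi_Q v).
Proof. exact: (Quotient.idealrBE submod_zmodClosed). Qed.

Lemma pi_quot_modD : {morph \pi_Q : u v / u + v}.
Proof. exact: (Quotient.pi_add submod_zmodClosed). Qed.

Definition qscale (c : R) (q : Q) : Q := \pi_Q (c *: repr q).

Lemma pi_scale c v : \pi_Q (c *: v) = qscale c (\pi_Q v).
Proof.
apply/eqP; rewrite -quot_mod_eq -scalerBr.
have [N0 Nlin] := Ncl; rewrite -[_ *: _]addr0 Nlin //.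
by rewrite quot_mod_eq reprK.
Qed.

Let qscaleA a b q : qscale a (qscale b q) = qscale (a * b) q.
Proof. by rewrite -[q]reprK -!pi_scale scalerA !reprK. Qed.
Let qscale1 : left_id 1 qscale.
Proof. by move=> q; rewrite -[q in LHS]reprK -pi_scale scale1r reprK. Qed.
Let qscaleDr : right_distributive qscale +%R.
Proof.
by move=> a u v; rewrite -[u]reprK -[v]reprK -pi_quot_modD -!pi_scale -pi_quot_modD scalerDr.
Qed.
Let qscaleDl q : {morph qscale^~ q : a b / a + b}.
Proof.
by move=> a b; rewrite -[q]reprK -!pi_scale -pi_quot_modD scalerDl.
Qed.

HB.instance Definition _ :=
  GRing.Zmodule_isLmodule.Build R Q qscaleA qscale1 qscaleDr qscaleDl.

End QuotientModule.

Definition direct_sum (V : zmodType) (I : finType) (M : {pred V})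
    (N : I -> {pred V}) : Prop :=
  [/\ forall i, zmod_closed (N i),
      forall f : {ffun I -> V}, (forall i, f i \in N i) -> \sum_i f i \in M
    & {in M, forall v, exists! f : {ffun I -> V},
        (forall i, f i \in N i) /\ v = \sum_i f i}].

Definition direct_sum2 (V : zmodType) (M A B : {pred V}) : Prop :=
  [/\ zmod_closed A, zmod_closed B,
      {in A & B, forall a b, a + b \in M}
    & {in M, forall v, exists! p : V * V,
        [/\ p.1 \in A, p.2 \in B & v = p.1 + p.2]}].

Definition has_half (K : pzRingType) : Prop := exists h : K, 2%:R * h = 1.

Section Derivations.
Variables (K : comPzRingType) (n : nat).
Local Notation L := (grass K n).

(* The codomain L^o (L as a left module over itself) gives the set of maps   *)
(* L -> L^o the left L-module structure (a *: d) b = a * d b.                 *)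
Definition gmap : Type := L -> L^o.
HB.instance Definition _ := GRing.Lmodule.on gmap.

Definition Der : {pred gmap} := fun d : L -> L =>
  `[< linear d /\ forall a b, d (a * b) = d a * b + a * d b >].

Definition Der_ev : {pred gmap} := fun d => (d \in Der) &&
  `[< {in geven K n, forall a, d a \in geven K n} /\
      {in godd K n, forall a, d a \in godd K n} >].

Definition Der_od : {pred gmap} := fun d => (d \in Der) &&
  `[< {in geven K n, forall a, d a \in godd K n} /\
      {in godd K n, forall a, d a \in geven K n} >].

Definition gad (a : L) : gmap := fun b => a * b - b * a.

Definition IDer : {pred gmap} := fun d => `[< exists a, d = gad a >].

Definition godd_pderiv (i : 'I_n) : {pred gmap} := fun d =>
  `[< exists2 a, a \in godd K n & d = fun b => a * pderiv i b >].

Lemma DerP (d : gmap) :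
  reflect (linear (d : L -> L) /\
           forall a b, d (a * b) = d a * b + a * (d b : L))
          (d \in Der).
Proof. exact: asboolP. Qed.

Lemma Der_closed : subring_submod_closed (geven K n) Der.
Proof.
split=> [|z /geven_central/gcentralP zC d e /DerP[dl dM] /DerP[el eM]].
  apply/DerP; split=> [c f g|f g]; first by rewrite scaler0 addr0.
  by rewrite mul0r mulr0 addr0.
apply/DerP; split=> [c f g|f g].
  have E h : (z *: d + e) h = z * d h + e h by [].
  rewrite !E dl el mulrDr !scalerDr -grass_scalerAr.
  by rewrite !addrA; congr (_ + _); rewrite addrAC.
have E h : (z *: d + e) h = z * d h + e h by [].
rewrite !E dM eM !mulrDr !mulrDl !mulrA -(zC f) -!addrA; congr (_ + _).
by rewrite addrCA.
Qed.

Lemma Der_ev_closed : subring_submod_closed (geven K n) Der_ev.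
Proof.
have [D0 Dl] := Der_closed.
split=> [|z zev d e /andP[dD /asboolP[de do_]] /andP[eD /asboolP[ee eo]]].
  by apply/andP; split=> //; apply/asboolP; split=> a _; apply: rpred0.
apply/andP; split; first exact: Dl.
apply/asboolP; split=> a ha; apply: rpredD.
- by apply: (gparityM zev); apply: de.
- exact: ee.
- by apply: (gparityM zev); apply: do_.
- exact: eo.
Qed.

Lemma IDer_scale (z : L) (d e : gmap) : z \in gcentral K n ->
  d \in IDer -> e \in IDer -> z *: d + e \in IDer.
Proof.
move=> /gcentralP zC /asboolP[a ->] /asboolP[b ->].
apply/asboolP; exists (z * a + b); apply/funext => f.
have -> : (z *: gad a + gad b) f = z * (a * f - f * a) + (b * f - f * b) by [].
rewrite /gad mulrDl !mulrDr mulrN opprD !mulrA -(zC f) -!mulrA.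
by rewrite -!addrA; congr (_ + _); rewrite addrCA.
Qed.

Lemma IDer0 : 0 \in IDer.
Proof.
apply/asboolP; exists 0; apply/funext => f.
by rewrite /gad mul0r mulr0 subrr.
Qed.

Lemma IDer_closed : subring_submod_closed (gcentral K n) IDer.
Proof. split; [exact: IDer0 | by move=> z zC d e; apply: IDer_scale]. Qed.

(* Without 1/2 the odd part need not be stable under the centre. *)
Lemma godd_closed : has_half K ->
  subring_submod_closed (V := L^o) (gcentral K n) (godd K n).
Proof.
move=> [h h2]; split; first exact: rpred0.
move=> z /gcentralP zC a b ha hb; apply: rpredD => //.
have : gproj true z * a = 0.
  have zC1 : gproj true z * a = a * gproj true z.
    have /gcentralP zC0 := geven_central (gproj_parity false z).
    have -> : gproj true z = z - gproj false z.
      by rewrite {2}(gproj_sum z) addrC addKr.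
    by rewrite mulrBl mulrBr zC zC0.
  have := gparity_comm (gproj_parity true z) ha.
  rewrite expr1 scaleN1r -zC1 => /eqP; rewrite -addr_eq0 -mulr2n => /eqP e.
  rewrite -[LHS]scale1r -h2 mulrC -scalerA.
  by rewrite scaler_nat e scaler0.
move=> z1a0; have -> : z *: (a : L^o) = gproj false z * a.
  by rewrite {1}(gproj_sum z) [LHS]mulrDl z1a0 addr0.
exact: (gparityM (gproj_parity false z) ha).
Qed.

Definition godd_mod (hK : has_half K) := submod_over (godd_closed hK).
Definition ider_mod := submod_over IDer_closed.
Definition der_mod := submod_over Der_closed.
Definition der_ev_mod := submod_over Der_ev_closed.
HB.instance Definition _ hK := GRing.Lmodule.on (godd_mod hK).
HB.instance Definition _ := GRing.Lmodule.on ider_mod.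
HB.instance Definition _ := GRing.Lmodule.on der_mod.
HB.instance Definition _ := GRing.Lmodule.on der_ev_mod.

Definition godd_central hK : {pred godd_mod hK} :=
  fun a => sval a \in gcentral K n.
Definition der_inner : {pred der_mod} := fun d => sval d \in IDer.

Lemma godd_central_closed hK : submod_closed (@godd_central hK).
Proof.
split=> [|z a b ha hb]; first exact: rpred0.
apply: rpredD => //; apply: rpredM => //; exact: valP z.
Qed.

Lemma der_inner_closed : submod_closed der_inner.
Proof.
split=> [|z a b ha hb]; first exact: IDer0.
apply: IDer_scale => //; apply: geven_central; exact: valP z.
Qed.

Definition godd_quot hK := quot_mod (@godd_central_closed hK).
Definition der_quot := quot_mod der_inner_closed.
HB.instance Definition _ hK := GRing.Lmodule.on (godd_quot hK).
HB.instance Definition _ := GRing.Lmodule.on der_quot.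

End Derivations.

Arguments Der : clear implicits.
Arguments Der_ev : clear implicits.
Arguments Der_od : clear implicits.
Arguments IDer : clear implicits.

(* Main.v *)
(* Fix a derivation d. Its parity-preserving and parity-reversing parts are   *)
(* again derivations, and d is determined by its values on x_1, ..., x_n. If  *)
(* d is even, the d(x_i) are odd, and sum_i d(x_i) \partial_i is a derivation *)
(* with the same values. If d is odd, the d(x_i) are even, hence central, so  *)
(* x_i x_j = - x_j x_i gives 2 (x_j d(x_i) + x_i d(x_j)) = 0. As 2 is         *)
(* invertible, Koszul exactness provides an odd a with x_i a = - d(x_i) / 2   *)
(* for all i, whence ad(a) = d. Finally Der / IDer is identified with Der^ev  *)
(* by sending d to its even part; the kernel of this map is Der^od = IDer.    *)

From HB Require Import structures.
Require Import Defs.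
From mathcomp Require Import boolp.
From mathcomp Require Import all_boot all_algebra ring.

Import GRing.Theory.
Local Open Scope ring_scope.
Local Open Scope quotient_scope.

(** By [Der_ext] a derivation is fixed by its values on the generators, so equalities of derivations
    are tested there. Sorting values by parity splits a derivation into two derivations,
    [parity_part false] and [parity_part true] ([parity_part_Der]). For an even derivation, the
    values on the generators are odd and are exactly its coefficients along the [pderiv i]
    ([Der_ev_sum]). For an odd one they are even, hence central; differentiating the anticommutation
    of the generators then gives Koszul relations, which [koszul_exact] solves by an element
    inducing the derivation ([Der_od_inner]). An odd central element is supported on the top
    monomial ([odd_central_coef]), so asking for a zero top coefficient makes the solution unique.
    Both module isomorphisms are instances of [quot_mod_iso], applied to [gad] and to the even
    part. *)

Section GrassmannDerivations.
Set Implicit Arguments.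
Unset Strict Implicit.
Variables (K : comPzRingType) (n : nat).
Local Notation L := (grass K n).
Implicit Types (a f g : L) (b c : bool) (A B C : {set 'I_n}) (i j : 'I_n) (d e : gmap K n).

(** * Parity projections and multiplication by a generator *)

Lemma grass_ind (P : L -> Prop) :
  P 0 -> (forall (c : K) A f, P f -> P (c *: gmono K A + f)) -> forall f, P f.
Proof. by move=> P0 PD f; rewrite (grass_basis f); elim/big_rec: _ => *; auto. Qed.

Lemma half_double_eq0 (hK : has_half K) f : f + f = 0 -> f = 0.
Proof.
case: hK => h h2 f2; rewrite -[f]scale1r -h2 mulrC -scalerA scaler_nat.
by rewrite mulr2n f2 scaler0.
Qed.

Lemma gmono_parity A : gmono K A \in gparity (odd #|A|).
Proof.
by apply/gparityP => B; rewrite gmonoE; case: (eqVneq B A) => // ->; rewrite eqxx.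
Qed.

Lemma ggen_odd i : ggen K i \in godd K n.
Proof. by have := gmono_parity [set i]; rewrite cards1. Qed.

Lemma odd_anticomm f g : f \in godd K n -> g \in godd K n -> f * g = - (g * f).
Proof. by move=> ha hb; rewrite (gparity_comm ha hb) expr1 scaleN1r. Qed.

Lemma even_comm a f : a \in geven K n -> a * f = f * a.
Proof. by move=> /geven_central/gcentralP. Qed.

Lemma gproj_linear b : linear (@gproj K n b).
Proof.
by move=> c f g; apply: grassP => A; rewrite grassDE grassZE /gproj !ffunE; case: eqP;
  rewrite ?mulr0 ?addr0.
Qed.
HB.instance Definition _ b :=
  GRing.isLinear.Build K L L *:%R (@gproj K n b) (gproj_linear b).

Lemma gproj_id b f : f \in gparity b -> gproj b f = f.
Proof.
move=> /gparityP hf; apply: grassP => A; rewrite ffunE.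
by case: eqP => // /eqP/hf->.
Qed.

Lemma gproj_eq0 b c f : f \in gparity c -> b != c -> gproj b f = 0.
Proof.
move=> /gparityP hf nbc; apply: grassP => A; rewrite ffunE grassE.
by case: eqP => // e; rewrite hf // e.
Qed.

(** A factor of parity [c] shifts parity by [c], so the projection passes it with index
    [b (+) c]. *)
Lemma gprojMl b c a f : a \in gparity c ->
  gproj b (a * f) = a * gproj (b (+) c) f.
Proof.
move=> ha; have h p := gparityM ha (gproj_parity p f).
rewrite [in LHS](gproj_sum f) mulrDr linearD /=.
by move: (h false) (h true); case: b; case: c {ha h} => h0 h1;
  rewrite ?(gproj_id h0) ?(gproj_id h1) ?(gproj_eq0 h0) ?(gproj_eq0 h1) ?addr0 ?add0r.
Qed.

Lemma gprojMr b c a f : a \in gparity c ->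
  gproj b (f * a) = gproj (b (+) c) f * a.
Proof.
move=> ha; have h p := gparityM (gproj_parity p f) ha.
rewrite [in LHS](gproj_sum f) mulrDl linearD /=.
by move: (h false) (h true); case: b; case: c {ha h} => h0 h1;
  rewrite ?(gproj_id h0) ?(gproj_id h1) ?(gproj_eq0 h0) ?(gproj_eq0 h1) ?addr0 ?add0r.
Qed.

Lemma grassM_genl f i C : (ggen K i * f) C =
  if i \in C then (-1) ^+ ninv [set i] (C :\ i) * f (C :\ i) else 0.
Proof.
rewrite grassME; have [iC|niC] := boolP (i \in C).
  rewrite (bigD1 [set i]) ?sub1set //= big1 => [|A /andP[_ /negPf nA]].
    by rewrite gmonoE eqxx mul1r addr0.
  by rewrite gmonoE nA mul0r mulr0.
rewrite big1 // => A AC; rewrite gmonoE; case: eqP => [e|]; last by rewrite mul0r mulr0.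
by rewrite e sub1set (negPf niC) in AC.
Qed.

(** Multiplication by a generator loses only the coefficients at sets containing its index; the
    others are recovered from the product, up to sign. *)
Lemma grassM_genl_coef f i B : i \notin B ->
  f B = (-1) ^+ ninv [set i] B * (ggen K i * f) (i |: B).
Proof.
by move=> niB; rewrite grassM_genl setU11 setU1K // mulrA -expr2 sqrr_sign mul1r.
Qed.

(** * A derivation is determined by its values on the generators *)

Lemma Der_linear d : d \in Der K n -> exists D : {linear L -> L}, D =1 (d : L -> L).
Proof.
move=> /DerP[dl _].
pose D : {linear L -> L} :=
  HB.pack (d : L -> L) (GRing.isLinear.Build K L L *:%R (d : L -> L) dl).
by exists D.
Qed.

Lemma Der1 d : d \in Der K n -> d 1 = 0.
Proof.
move=> /DerP[_ /(_ 1 1)]; rewrite !mulr1 mul1r => /eqP.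
by rewrite -{1}[d 1]addr0 (inj_eq (addrI _)) eq_sym => /eqP.
Qed.

(** Induction on the size of a monomial: [gmonoD1] peels off one generator and the Leibniz rule
    handles the product. *)
Lemma Der_ext d e : d \in Der K n -> e \in Der K n ->
  (forall i, d (ggen K i) = e (ggen K i)) -> d = e.
Proof.
move=> dD eD eq_gen; have [D DE] := Der_linear dD; have [E EE] := Der_linear eD.
have mono A : d (gmono K A) = e (gmono K A) :> L.
  have [m] := ubnP #|A|; elim: m A => // m IHm A leAm.
  have [->|[j jA]] := set_0Vmem A; first by rewrite !Der1.
  rewrite (gmonoD1 _ jA) -DE -EE !linearZ /= DE EE; congr (_ *: _).
  have [_ dM] := DerP _ dD; have [_ eM] := DerP _ eD.
  by rewrite dM eM eq_gen IHm //; move: leAm; rewrite (cardsD1 j) jA.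
apply/funext; apply: grass_ind => [|c A f IH]; rewrite -DE -EE ?linear0 //.
by rewrite !linearP /= !DE !EE mono IH.
Qed.

(** * Even and odd parts of a derivation *)

Definition parity_part (c : bool) d : gmap K n := fun f : L =>
  gproj (false (+) c) (d (gproj false f)) + gproj (true (+) c) (d (gproj true f)) : L.

Lemma parity_partE c d b f : d \in Der K n -> f \in gparity b ->
  parity_part c d f = gproj (b (+) c) (d f).
Proof.
move=> /Der_linear[D DE] hf; rewrite /parity_part -!DE.
case: b hf => hf; rewrite (gproj_id hf) (gproj_eq0 hf) //.
  by rewrite !linear0 add0r.
by rewrite !linear0 addr0.
Qed.

Lemma parity_part_sum d : d \in Der K n -> d = parity_part false d + parity_part true d.
Proof.
move=> /Der_linear[D DE]; apply/funext => f.
have E (p q : gmap K n) : (p + q) f = (p f + q f : L) by [].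
rewrite E /parity_part /= -!DE [in LHS](gproj_sum f) linearD /=.
rewrite [in LHS](gproj_sum (D (gproj false f))) [in LHS](gproj_sum (D (gproj true f))).
by rewrite -!addrA; congr (_ + _); rewrite addrA addrC.
Qed.

(** For homogeneous factors, projecting the Leibniz rule for [d] onto a single parity gives that of
    the part; biadditivity then covers all factors. *)
Lemma parity_part_Der c d : d \in Der K n -> parity_part c d \in Der K n.
Proof.
move=> dD; have [D DE] := Der_linear dD; have [_ dM] := DerP _ dD.
have pl : linear (parity_part c d : L -> L).
  move=> k f g; rewrite /parity_part -!DE !linearP /= scalerDr.
  by rewrite addrACA.
pose P : {linear L -> L} := HB.pack (parity_part c d : L -> L)
  (GRing.isLinear.Build K L L *:%R (parity_part c d : L -> L) pl).
apply/DerP; split=> // f g.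
have key p q u v : u \in gparity p -> v \in gparity q ->
    P (u * v) = P u * v + u * P v.
  move=> hu hv; rewrite /P /= (parity_partE c dD hu) (parity_partE c dD hv).
  rewrite (parity_partE c dD (gparityM hu hv)) dM linearD /=.
  rewrite (gprojMr _ _ hv) (gprojMl _ _ hu).
  by congr (gproj _ _ * _ + _ * gproj _ _); case: (p); case: (q); case: (c).
change (P (f * g) = P f * g + f * P g).
have PD : {morph P : u v / u + v} by exact: linearD.
have keyl p u v : u \in gparity p -> P (u * v) = P u * v + u * P v.
  move=> hu; rewrite (gproj_sum v) mulrDr !PD.
  by rewrite !(key _ _ _ _ hu (gproj_parity _ _)) !mulrDr addrACA.
rewrite (gproj_sum f) mulrDl !PD.
by rewrite !(keyl _ _ _ (gproj_parity _ _)) !mulrDl addrACA.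
Qed.

Lemma parity_part_parity c d b f : d \in Der K n -> f \in gparity b ->
  parity_part c d f \in gparity (b (+) c).
Proof. by move=> dD hf; rewrite (parity_partE c dD hf) gproj_parity. Qed.

Lemma pderiv_parity i b f : f \in gparity b -> pderiv i f \in gparity (~~ b).
Proof.
move=> /gparityP hf; apply/gparityP => A nA; rewrite pderivE.
case: ifPn => // niA; rewrite hf ?mulr0 // cardsU1 niA /=.
by move: nA; case: (odd _); case: (b).
Qed.

(** The skew sign of [pderiv i] at a monomial cancels the sign from moving the odd [a] past that
    monomial. *)
Lemma pderiv_Der a i : a \in godd K n ->
  ((fun f => a * pderiv i f) : gmap K n) \in Der K n.
Proof.
move=> ha.
have pl : linear (fun f : L => a * pderiv i f).
  by move=> c f g; rewrite pderiv_is_linear mulrDr -grass_scalerAr.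
pose P : {linear L -> L} := HB.pack (fun f : L => a * pderiv i f)
  (GRing.isLinear.Build K L L *:%R (fun f : L => a * pderiv i f) pl).
apply/DerP; split=> // f g; change (P (f * g) = P f * g + f * P g).
elim/grass_ind: f => [|c A f IH]; first by rewrite mul0r linear0 !mul0r addr0.
have mono : P (gmono K A * g) = P (gmono K A) * g + gmono K A * P g.
  rewrite /P /= (pderiv_skew _ _ (gmono_homog K A)) mulrDr mulrA; congr (_ + _).
  rewrite -grass_scalerAr !mulrA (gparity_comm (gmono_parity A) ha) andbT.
  by rewrite signr_odd grass_scalerAl.
rewrite mulrDl -grass_scalerAl !linearP IH mono /= !mulrDl !scalerDr.
by rewrite -!grass_scalerAl -!addrA; congr (_ + _); rewrite addrCA.
Qed.

Lemma Der_evP d : reflect (d \in Der K n /\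
   forall b f, f \in gparity b -> (d f : L) \in gparity b) (d \in Der_ev K n).
Proof.
apply: (iffP andP) => [[dD /asboolP[he ho]]|[dD h]]; split=> //.
  by case=> f; [exact: ho | exact: he].
by apply/asboolP; split=> f; exact: h.
Qed.

Lemma Der_odP d : reflect (d \in Der K n /\
   forall b f, f \in gparity b -> (d f : L) \in gparity (~~ b)) (d \in Der_od K n).
Proof.
apply: (iffP andP) => [[dD /asboolP[he ho]]|[dD h]]; split=> //.
  by case=> f; [exact: ho | exact: he].
by apply/asboolP; split=> f; exact: h.
Qed.

Lemma parity_part_ev d : d \in Der K n -> parity_part false d \in Der_ev K n.
Proof.
move=> dD; apply/Der_evP; split=> [|b f hf]; first exact: parity_part_Der.
by rewrite -[b]addbF parity_part_parity.
Qed.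

Lemma parity_part_od d : d \in Der K n -> parity_part true d \in Der_od K n.
Proof.
move=> dD; apply/Der_odP; split=> [|b f hf]; first exact: parity_part_Der.
by rewrite -addbT parity_part_parity.
Qed.

Lemma Der_ev_part d : d \in Der_ev K n -> parity_part false d = d.
Proof.
move=> /Der_evP[dD h]; apply: Der_ext => // [|i]; first exact: parity_part_Der.
by rewrite (parity_partE _ dD (ggen_odd i)) gproj_id // h // ggen_odd.
Qed.

Lemma Der_od_part d : d \in Der_od K n -> parity_part false d = 0.
Proof.
move=> /Der_odP[dD h]; apply: Der_ext => // [||i]; first exact: parity_part_Der.
  by case: (Der_closed K n).
by rewrite (parity_partE _ dD (ggen_odd i)) (gproj_eq0 (h _ _ (ggen_odd i))).
Qed.

Lemma parity_part_od_eq d : d \in Der K n -> parity_part false d = 0 ->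
  d \in Der_od K n.
Proof.
by move=> dD d0; rewrite (parity_part_sum dD) d0 add0r parity_part_od.
Qed.

(** Even scalars preserve parity; this is what makes the even part a map of modules over [geven]. *)
Lemma parity_part_lin c z d e : z \in geven K n -> d \in Der K n -> e \in Der K n ->
  parity_part c (z *: d + e) = z *: parity_part c d + parity_part c e.
Proof.
move=> hz dD eD; have [_ Dl] := Der_closed K n; have zdD := Dl _ hz _ _ dD eD.
have [_ Dl'] := Der_closed K n.
apply: Der_ext => [||i]; [exact: parity_part_Der | by apply: Dl'; rewrite ?parity_part_Der|].
have E (p q : gmap K n) f : (z *: p + q) f = (z * p f + q f : L) by [].
rewrite E !(parity_partE _ _ (ggen_odd i)) // E linearD /=.
by rewrite (gprojMl _ _ hz) addbF.
Qed.

(** The even part is additive, the identity on even derivations and zero on odd ones; closure under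
    subtraction and uniqueness of the splitting both come from this. *)
Lemma Der_parity_sum : direct_sum2 (Der K n) (Der_ev K n) (Der_od K n).
Proof.
have [D0 Dl] := Der_closed K n.
have DB : zmod_closed (Der K n).
  split=> // d e dD eD; rewrite addrC -scaleN1r; apply: Dl => //; exact: rpredN1.
have pB d e : d \in Der K n -> e \in Der K n ->
    parity_part false (d - e) = parity_part false d - parity_part false e.
  move=> dD eD; rewrite addrC -scaleN1r parity_part_lin ?rpredN1 //.
  by rewrite scaleN1r addrC.
have evD d : d \in Der_ev K n -> d \in Der K n by case/andP.
have odD d : d \in Der_od K n -> d \in Der K n by case/andP.
split.
- split=> [|d e hd he]; first by case: (Der_ev_closed K n).
  rewrite -(Der_ev_part hd) -(Der_ev_part he) -pB ?evD //.
  by apply/parity_part_ev/DB.2; exact: evD.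
- split=> [|d e hd he].
    apply: parity_part_od_eq => //; rewrite -[X in parity_part _ X](subrr 0).
    by rewrite pB // subrr.
  apply: parity_part_od_eq; first by apply: DB.2; exact: odD.
  by rewrite pB ?odD // !Der_od_part // subrr.
- move=> d e /evD dD /odD eD; rewrite -[d]scale1r; apply: Dl => //; exact: rpred1.
move=> d dD; exists (parity_part false d, d - parity_part false d); split=> /=.
  split; [exact: parity_part_ev | | by rewrite addrC subrK].
  by rewrite [X in X - _](parity_part_sum dD) addrC addKr parity_part_od.
case=> d0 d1 [/= h0 h1 ->].
have -> : parity_part false (d0 + d1) = d0.
  rewrite -{1}[d0]scale1r parity_part_lin ?rpred1 ?(evD _ h0) ?(odD _ h1) //.
  by rewrite scale1r (Der_ev_part h0) (Der_od_part h1) addr0.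
by rewrite addrC addKr.
Qed.

(** * Even derivations as combinations of the partial skew derivatives *)

Lemma gmap_sumE (I : Type) (r : seq I) (P : pred I) (F : I -> gmap K n) (f : L) :
  (\sum_(i <- r | P i) F i) f = \sum_(i <- r | P i) (F i f : L) :> L.
Proof. by elim/big_rec2: _ => // i y1 y2 _ <-. Qed.

Lemma godd_pderiv_ev i d : d \in godd_pderiv i -> d \in Der_ev K n.
Proof.
move=> /asboolP[a ha ->]; apply/Der_evP; split=> [|b f hf]; first exact: pderiv_Der.
have -> : b = (true (+) ~~ b)%B by case: (b).
exact: gparityM ha (pderiv_parity i hf).
Qed.

Lemma godd_pderiv_gen i j d : d \in godd_pderiv i ->
  d (ggen K j) = if i == j then d (ggen K i) else 0.
Proof.
move=> /asboolP[a ha ->]; rewrite !pderiv_gen.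
by case: eqP => [->|_]; rewrite ?eqxx ?mulr0.
Qed.

Lemma Der_ev_sum : direct_sum (Der_ev K n) (@godd_pderiv K n).
Proof.
have [E0 El] := Der_ev_closed K n.
have sum_ev (F : 'I_n -> gmap K n) : (forall i, F i \in godd_pderiv i) ->
    \sum_i F i \in Der_ev K n.
  move=> hF; elim/big_rec: _ => // i d _ hd; rewrite -[F i]scale1r.
  by apply: El => //; [exact: rpred1 | exact: (@godd_pderiv_ev i)].
(* Only the summand of index [j] sees the generator [j]; this forces the coefficients and so gives
   uniqueness. *)
have sum_gen (F : 'I_n -> gmap K n) j : (forall i, F i \in godd_pderiv i) ->
    (\sum_i F i) (ggen K j) = F j (ggen K j).
  move=> hF; rewrite gmap_sumE (bigD1 j) //= big1 ?addr0 // => i /negPf nij.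
  by rewrite (godd_pderiv_gen _ (hF i)) nij.
split=> [i|F /sum_ev|d hd] //.
  split=> [|d e /asboolP[a ha ->] /asboolP[b hb ->]].
    by apply/asboolP; exists 0; [exact: rpred0 | apply/funext => f; rewrite mul0r].
  apply/asboolP; exists (a - b); first exact: rpredB.
  by apply/funext => f; rewrite mulrBl.
have evD e : e \in Der_ev K n -> e \in Der K n by case/andP.
pose F := [ffun i => (fun f => d (ggen K i) * pderiv i f) : gmap K n].
have hF i : F i \in godd_pderiv i.
  rewrite /F ffunE; apply/asboolP; exists (d (ggen K i)) => //.
  by have /Der_evP[_ ] := hd; apply; exact: ggen_odd.
exists F; split; first split=> //.
  apply: Der_ext => [||j]; [exact: evD | exact/evD/sum_ev | rewrite sum_gen //].
  by rewrite /F ffunE pderiv_gen eqxx mulr1.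
move=> G [hG dG]; apply/ffunP => i; apply: Der_ext => [||j]; try exact/evD/(@godd_pderiv_ev i).
rewrite (godd_pderiv_gen _ (hF i)) (godd_pderiv_gen _ (hG i)); case: eqP => // _.
by rewrite /F ffunE dG sum_gen // pderiv_gen eqxx mulr1.
Qed.

(** * Inner derivations and Koszul exactness *)

Lemma gad_Der a : gad a \in Der K n.
Proof.
apply/DerP; split=> [c f g|f g]; rewrite /gad.
  rewrite mulrDr mulrDl -grass_scalerAl -grass_scalerAr scalerBr opprD.
  by rewrite addrACA.
by rewrite mulrBl mulrBr !mulrA addrACA [- _ + _]addrC addrACA subrr addr0.
Qed.

Lemma gadB a a' : gad (a - a') = gad a - gad a'.
Proof.
apply/funext => f; have E (p q : gmap K n) : (p - q) f = (p f - q f : L) by [].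
by rewrite E /gad mulrBl mulrBr opprD opprK addrACA [X in _ + X]addrC opprB.
Qed.

Lemma gad_eq0 a : gad a = 0 <-> a \in gcentral K n.
Proof.
split=> [a0|/gcentralP aC]; last by apply/funext => f; rewrite /gad aC subrr.
by apply/gcentralP => f; apply/eqP; rewrite -subr_eq0 -[_ - _]/(gad a f) a0.
Qed.

(* An even element is central, so only the odd part of [a] contributes. *)
Lemma gad_od a : gad a \in Der_od K n.
Proof.
have -> : gad a = gad (gproj true a).
  apply/eqP; rewrite -subr_eq0 -gadB; apply/eqP/gad_eq0/geven_central.
  by rewrite {1}(gproj_sum a) addrK gproj_parity.
apply/Der_odP; split=> [|b f hf]; first exact: gad_Der.
have ha := gproj_parity true a.
have -> : ~~ b = (true (+) b)%B by [].
by apply: rpredB; [exact: gparityM | rewrite addbC; exact: gparityM].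
Qed.

(* Exactness of the Koszul complex for left multiplication by the generators: *)
(* the relations x_j c_i = - x_i c_j (with i = j allowed) let the coefficient *)
(* of [a] at B be read off from that of c_i at B u {i}, for any i not in B.   *)
Lemma koszul_exact (hK : has_half K) (c : 'I_n -> L) :
  (forall i j, ggen K j * c i = - (ggen K i * c j)) ->
  exists2 a : L, a [set: 'I_n] = 0 & forall i, ggen K i * a = c i.
Proof.
move=> hc.
(* The relation with equal indices says that twice [ggen K i * c i] is zero, so [c i] is supported
   on sets containing [i]. *)
have c_notin i B : i \notin B -> c i B = 0.
  move=> niB; rewrite (grassM_genl_coef _ niB) (_ : ggen K i * c i = 0).
    by rewrite grass0E mulr0.
  by apply: (half_double_eq0 hK); rewrite {1}hc addNr.
(* Comparing coefficients at [i |: (j |: B)] in the relation shows that the coefficient of the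
   solution at [B] does not depend on the chosen index. *)
have c_swap i j B : i \notin B -> j \notin B ->
    (-1) ^+ ninv [set i] B * c i (i |: B) = (-1) ^+ ninv [set j] B * c j (j |: B).
  move=> niB njB; have [->//|nij] := eqVneq i j.
  have := congr1 (fun f : L => f (i |: (j |: B))) (hc i j).
  rewrite grassNE !grassM_genl !inE !eqxx orbT /= setU1K ?inE ?negb_or ?nij //.
  rewrite setUCA setU1K ?inE ?negb_or 1?eq_sym ?nij //.
  have di : [disjoint [set i] & B] by rewrite disjoints1.
  have dj : [disjoint [set j] & B] by rewrite disjoints1.
  rewrite !ninvUr //.
  have := @ninv_sym _ [set i] [set j]; rewrite disjoints1 inE nij !cards1 => /(_ isT).
  have sgn (p q : nat) : (p + q = 1)%N -> (-1 : K) ^+ p = - (-1) ^+ q.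
    by case: p => [|[|//]]; case: q => [|[|//]] //= _; rewrite ?expr0 ?expr1 ?opprK.
  move=> /sgn e; rewrite !exprD e => h.
  have s2 p := sqrr_sign K p.
  have := s2 (ninv [set j] [set i]); have := s2 (ninv [set i] B).
  have := s2 (ninv [set j] B); move: h; rewrite !expr2.
  set s := (-1) ^+ _; set u := _ ^+ ninv [set j] B; set v := _ ^+ ninv [set i] B.
  move=> h uu vv ss.
  transitivity (s * u * v * (s * u * c i (i |: B))); first by ring: ss uu.
  by rewrite h; ring: ss vv.
(* Any index outside [B] would do, by [c_swap]. The default 0 is reached only at the full set, and
   yields the zero top coefficient. *)
pose a : L := [ffun B : {set 'I_n} =>
  if [pick i | i \notin B] is Some i then (-1) ^+ ninv [set i] B * c i (i |: B) else (0 : K)].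
exists a; first by rewrite ffunE; case: pickP => // i; rewrite inE.
move=> i; apply: grassP => C; rewrite grassM_genl.
case: ifPn => [iC|/c_notin->//].
rewrite ffunE; case: pickP => [j nj|/(_ i)]; last by rewrite !inE eqxx.
have niC : i \notin C :\ i by rewrite !inE eqxx.
rewrite (c_swap _ _ _ nj niC) setD1K // mulrA -expr2 sqrr_sign.
by rewrite mul1r.
Qed.

(** * Odd central elements and their complement *)

Lemma odd_central_coef (hK : has_half K) a B :
  a \in godd K n -> a \in gcentral K n -> B != [set: 'I_n] -> a B = 0.
Proof.
move=> ha /gcentralP aC; rewrite -subTset => /subsetPn[i _ niB].
have xa : ggen K i * a = 0.
  by apply: (half_double_eq0 hK); rewrite {1}(odd_anticomm (ggen_odd i) ha) aC addNr.
by rewrite (grassM_genl_coef _ niB) xa grass0E mulr0.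
Qed.

Lemma godd'_intro a : a \in godd K n -> a [set: 'I_n] = 0 -> a \in godd' K n.
Proof. by move=> ha aT; apply/andP; rewrite aT eqxx implybT. Qed.

(** If [n] is even, the top monomial is even and an odd element has no coefficient there; so
    membership in [godd'] means odd with zero top coefficient, whatever the parity of [n]. *)
Lemma godd'_coefT a : a \in godd' K n -> a [set: 'I_n] = 0.
Proof.
case/andP => /gparityP ha; case: (boolP (odd n)) => [on /eqP // | en _].
by apply: ha; rewrite cardsT card_ord (negPf en).
Qed.

Lemma godd'_central (hK : has_half K) a :
  a \in godd' K n -> a \in gcentral K n -> a = 0.
Proof.
move=> ha aC; apply: grassP => B; rewrite grass0E.
have [->|nB] := eqVneq B setT; first exact: godd'_coefT.
by apply: (odd_central_coef hK) aC nB; case/andP: ha.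
Qed.

Lemma godd'B : zmod_closed (godd' K n).
Proof.
split=> [|a b /[dup]/godd'_coefT aT /andP[ha _] /[dup]/godd'_coefT bT /andP[hb _]].
  by apply: godd'_intro; rewrite ?rpred0 ?grass0E.
by apply: godd'_intro; rewrite ?rpredB // !grassE aT bT subrr.
Qed.

(** The top monomial kills every monomial but 1, from either side. *)
Lemma gmonoT_central (c : K) : c *: gmono K [set: 'I_n] \in gcentral K n.
Proof.
apply/gcentralP; elim/grass_ind => [|k A f IH]; first by rewrite mulr0 mul0r.
rewrite mulrDl mulrDr IH; congr (_ + _).
rewrite -grass_scalerAl -!grass_scalerAr -grass_scalerAl; do 2!congr (_ *: _).
rewrite !gmonoM -!setI_eq0 setTI setIT; case: eqP => // ->.
by rewrite ninvs0 ninv0s setU0 set0U.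
Qed.

Lemma godd_sum (hK : has_half K) : direct_sum2 (godd K n) (godd' K n)
  [predI godd K n & gcentral K n].
Proof.
split; first exact: godd'B.
- split=> [|a b /andP[ha aC] /andP[hb bC]]; apply/andP; split; rewrite ?rpred0 //.
    by rewrite rpredB.
  by rewrite rpredB.
- by move=> a b /andP[ha _] /andP[hb _]; rewrite rpredD.
(* The central summand must be the top term of [a]. *)
move=> a ha; pose t := a [set: 'I_n] *: gmono K [set: 'I_n].
have tE B : t B = a [set: 'I_n] * (B == setT)%:R by rewrite grassE gmonoE.
have ht : t \in godd K n.
  apply/gparityP => B nB; rewrite tE; case: eqP => [eB|]; last by rewrite mulr0.
  by move/gparityP: ha => ->; rewrite ?mul0r -?eB.
exists (a - t, t); split=> /=.
  split; last by rewrite subrK.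
    by apply: godd'_intro; rewrite ?rpredB // !grassE gmonoE eqxx mulr1 subrr.
  by apply/andP; split=> //; exact: gmonoT_central.
case=> u v [/= hu /andP[hv vC] e].
have -> : t = v.
  apply: grassP => B; rewrite tE; have [->|nB] := eqVneq B setT.
    by rewrite mulr1 e grassE (godd'_coefT hu) add0r.
  by rewrite mulr0 (odd_central_coef hK hv vC nB).
by rewrite e addrK.
Qed.

(** * Odd derivations are inner *)

Lemma Der_od_inner (hK : has_half K) d : d \in Der_od K n ->
  exists2 a, a \in godd' K n & gad a = d.
Proof.
move=> /Der_odP[dD h]; have [_ dM] := DerP _ dD; have [D DE] := Der_linear dD.
have [k k2] := hK.
have hev i : (d (ggen K i) : L) \in geven K n by exact: h (ggen_odd i).
(* For odd [a], [gad a] sends the generator [i] to [-2] times [ggen K i * a]; hence the target is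
   minus half of the value of [d]. *)
pose c i : L := - (k *: (d (ggen K i) : L)).
have xc i j : ggen K j * c i = - (ggen K i * c j).
  suff e : ggen K j * (d (ggen K i) : L) = - (ggen K i * (d (ggen K j) : L)).
    by rewrite /c !mulrN -!grass_scalerAr e scalerN.
  apply/eqP; rewrite -addr_eq0; apply/eqP; apply: (half_double_eq0 hK).
  have : d (ggen K i * ggen K j) = - d (ggen K j * ggen K i) :> L.
    by rewrite (odd_anticomm (ggen_odd i) (ggen_odd j)) -DE linearN /= DE.
  rewrite !dM (even_comm _ (hev i)) (even_comm _ (hev j)).
  by move/eqP; rewrite -addr_eq0 [X in _ + X]addrC => /eqP.
have [a aT ha] := koszul_exact hK xc.
(* At a set of even size missing [i], the coefficient of [a] is up to sign that of [c i] at a set of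
   odd size, which is zero because [d (ggen K i)] is even. *)
have a_odd : a \in godd K n.
  apply/gparityP => B oB; have [->//|] := eqVneq B setT.
  rewrite -subTset => /subsetPn[i _ niB].
  rewrite (grassM_genl_coef _ niB) ha !grassE.
  have /gparityP -> := hev i; first by rewrite mulr0 oppr0 mulr0.
  by rewrite cardsU1 niB /=; move: oB; case: odd.
exists a; first exact: godd'_intro.
apply: Der_ext => [||i] //; first exact: gad_Der.
rewrite /gad (odd_anticomm a_odd (ggen_odd i)) ha /c !opprK -scalerDl -mulr2n.
by rewrite -mulr_natl k2 scale1r.
Qed.

Lemma IDer_Der_od (hK : has_half K) : Der_od K n =i IDer K n.
Proof.
move=> d; apply/idP/idP => [/(Der_od_inner hK)[a _ <-]|/asboolP[a ->]].
  by apply/asboolP; exists a.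
exact: gad_od.
Qed.

Lemma gadM z a : z \in gcentral K n -> gad (z * a) = z *: gad a.
Proof.
move=> /gcentralP zC; apply/funext => f; rewrite -[RHS]/(z * (a * f - f * a)) /gad.
by rewrite mulrBr !mulrA -(zC f).
Qed.

Lemma gadD a a' : gad (a + a') = gad a + gad a'.
Proof.
by rewrite -[a' in LHS]opprK gadB -[X in _ - gad X]sub0r gadB (_ : gad 0 = 0)
  ?sub0r ?opprK //; apply/gad_eq0; exact: rpred0.
Qed.

End GrassmannDerivations.

(** * First isomorphism theorem and the two module isomorphisms *)

Lemma quot_mod_iso (R : pzRingType) (V W : lmodType R) (N : {pred V})
    (Ncl : submod_closed N) (g : {linear V -> W}) :
  (forall v, g v = 0 <-> v \in N) -> (forall w, exists v, g v = w) ->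
  exists f : {linear quot_mod Ncl -> W},
    bijective f /\ forall v, f (\pi_(quot_mod Ncl) v) = g v.
Proof.
(* Representatives of one class differ by an element of [N], the kernel of [g], so [g] of the chosen
   one is independent of the choice. *)
move=> kerg surjg; pose f (q : quot_mod Ncl) := g (repr q).
have fE v : f (\pi_(quot_mod Ncl) v) = g v.
  apply/eqP; rewrite -subr_eq0 -linearB; apply/eqP/kerg.
  by rewrite quot_mod_eq reprK.
have fl : linear f.
  move=> c p q; rewrite -[p]reprK -[q]reprK -[_ *: _]pi_scale -[_ + _]pi_quot_modD.
  by rewrite !fE linearP.
pose F : {linear quot_mod Ncl -> W} := HB.pack f
  (GRing.isLinear.Build R (quot_mod Ncl) W *:%R f fl).
exists F; split=> //.
have [s sK] := choice surjg.
exists (fun w => \pi_(quot_mod Ncl) (s w)) => [q|w]; last by rewrite /F /= fE.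
rewrite -[RHS]reprK; apply/eqP; rewrite -quot_mod_eq; apply/kerg.
by rewrite linearB sK subrr.
Qed.

Section Isomorphisms.
Set Implicit Arguments.
Unset Strict Implicit.
Variables (K : comPzRingType) (n : nat).

(** The kernel of [gad] on odd elements is their central part, and [Der_od_inner] provides
    surjectivity. *)
Lemma gad_iso (hK : has_half K) : exists f : {linear godd_quot n hK -> ider_mod K n},
  bijective f /\ forall a : godd_mod n hK,
    sval (f (\pi_(godd_quot n hK) a)) = gad (sval a).
Proof.
have inner (a : grass K n) : gad a \in IDer K n by apply/asboolP; exists a.
pose g (a : godd_mod n hK) : ider_mod K n :=
  exist (fun d => d \in IDer K n) (gad (sval a)) (inner (sval a)).
have gl : linear g.
  move=> z a b; apply: val_inj.
  by rewrite [LHS]/= gadD gadM //; exact: valP z.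
pose G : {linear godd_mod n hK -> ider_mod K n} := HB.pack g
  (GRing.isLinear.Build _ (godd_mod n hK) (ider_mod K n) *:%R g gl).
have [||f [f_bij fE]] := @quot_mod_iso _ _ _ _ (godd_central_closed n hK) G.
- move=> v; split=> [/(congr1 val)/gad_eq0 //|v0]; apply: val_inj.
  exact/gad_eq0.
- move=> [d hd]; have := hd; rewrite -(IDer_Der_od hK) => /(Der_od_inner hK)[a ha e].
  have /andP[ao _] := ha.
  by exists (exist _ a ao); apply: val_inj.
by exists f; split=> // a; rewrite fE.
Qed.

Lemma Der_quot_iso (hK : has_half K) :
  exists f : {linear der_quot K n -> der_ev_mod K n}, bijective f.
Proof.
pose g (d : der_mod K n) : der_ev_mod K n :=
  exist (fun d => d \in Der_ev K n) (parity_part false (sval d))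
    (parity_part_ev (valP d)).
have gl : linear g.
  move=> z d e; apply: val_inj.
  exact: parity_part_lin (valP z) (valP d) (valP e).
pose G : {linear der_mod K n -> der_ev_mod K n} := HB.pack g
  (GRing.isLinear.Build _ (der_mod K n) (der_ev_mod K n) *:%R g gl).
have [||f [f_bij _]] := @quot_mod_iso _ _ _ _ (der_inner_closed K n) G; last by exists f.
- move=> d; split=> [/(congr1 val)/(parity_part_od_eq (valP d))|].
    by rewrite IDer_Der_od.
  move=> hd; apply: val_inj; apply: Der_od_part; rewrite IDer_Der_od //.
- move=> [e he]; have /andP[eD _] := he.
  by exists (exist _ e eD); apply: val_inj; exact: Der_ev_part.
Qed.

End Isomorphisms.

Theorem theorem2p1 (K : comPzRingType) (n : nat)
    (hK : has_half K) (hn : (0 < n)%N) :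
  [/\ direct_sum2 (Der K n) (Der_ev K n) (Der_od K n),
      direct_sum (Der_ev K n) (@godd_pderiv K n),
      [/\ Der_od K n =i IDer K n,
          direct_sum2 (godd K n) (godd' K n)
            [predI godd K n & gcentral K n],
          {in godd' K n, forall a, gad a \in IDer K n} /\
          {in IDer K n, forall d, exists! a, a \in godd' K n /\ gad a = d}
        & exists f : {linear godd_quot n hK -> ider_mod K n},
            bijective f /\
            forall a : godd_mod n hK,
              sval (f (\pi_(godd_quot n hK) a)) = gad (sval a)]
    & exists f : {linear der_quot K n -> der_ev_mod K n}, bijective f].
Proof.
split; [exact: Der_parity_sum | exact: Der_ev_sum | | exact: Der_quot_iso].
split; [exact: IDer_Der_od | exact: godd_sum | | exact: gad_iso].
split=> [a _|d]; first by apply/asboolP; exists a.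
rewrite -(IDer_Der_od hK) => /(Der_od_inner hK)[a ha <-].
(* Two preimages in [godd'] differ by a central element of [godd'], which is zero. *)
exists a; split=> // b [hb eb]; apply/eqP; rewrite -subr_eq0; apply/eqP.
apply: (godd'_central hK); first exact: (godd'B K n).2.
by apply/gad_eq0; rewrite gadB eb subrr.
Qed.
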